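(* Let $F$ be a field, let $D$ be a quaternion division algebra over $F$ and $c\in D^\times\setminus F$. Then $D$ is the only quaternion subalgebra of each of the algebras $\mathrm{Cay}_m(D,c)$ and $\mathrm{Cay}_r(D,c)$.
   Context: For a quaternion algebra $D$ over $F$ (any characteristic) with canonical involution $x\mapsto\bar x$ and $c\in D^\times\setminus F$, the $F$-vector space $D\oplus D$ becomes a unital $F$-algebra with unit $(1,0)$ under each of the following multiplications ($u,v,u',v'\in D$): $\mathrm{Cay}_m(D,c)$: $(u,v)(u',v')=(uu'+\bar{v'}cv,\ v'u+v\bar{u'})$; $\mathrm{Cay}_r(D,c)$: $(u,v)(u',v')=(uu'+\bar{v'}v\,c,\ v'u+v\bar{u'})$. $D$ is identified with the subalgebra $D\oplus 0$. A quaternion subalgebra is a (unital) $F$-subalgebra that is a quaternion algebra over $F$. *)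

(* Defs.v *)
From HB Require Import structures.
From mathcomp Require Import all_boot all_order all_algebra all_field.
Set Implicit Arguments.
Unset Strict Implicit.
Unset Printing Implicit Defensive.
Import GRing.Theory.
Local Open Scope ring_scope.

(* Unital, not necessarily associative, F-algebra structures on V. *)
Record unital_alg (F : fieldType) (V : vectType F) := UnitalAlg {
  amul : V -> V -> V;
  aone : V;
  amul_bilinear : bilinear_for *:%R *:%R amul;
  amul1x : left_id aone amul;
  amulx1 : right_id aone amul
}.

Section Quaternion.
Variables (F : fieldType) (V : vectType F) (A : unital_alg V).
Implicit Types B I : {vspace V}.
Local Notation "x ** y" := (amul A x y) (at level 40, left associativity).

Definition subalgebra B : Prop :=
  aone A \in B /\ {in B &, forall x y, x ** y \in B}.

Definition ideal_of B I : Prop :=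
  (I <= B)%VS /\ {in B & I, forall b x, b ** x \in I /\ x ** b \in I}.

Definition associative_on B : Prop :=
  {in B & B & B, forall x y z, x ** (y ** z) = x ** y ** z}.

Definition central_on B : Prop :=
  {in B, forall z, {in B, forall x, z ** x = x ** z} -> z \in <[aone A]>%VS}.

Definition simple_on B : Prop :=
  B != 0%VS /\ forall I, ideal_of B I -> I = 0%VS \/ I = B.

(* A quaternion algebra over F, in any characteristic, is an associative
   central simple F-algebra of dimension 4. *)
Definition quaternion_subalgebra B : Prop :=
  [/\ subalgebra B, associative_on B, central_on B, simple_on B & \dim B = 4].

End Quaternion.

Section AlgOf.
Variables (F : fieldType) (D : falgType F).

Fact falg_mul_bilinear : bilinear_for *:%R *:%R ( *%R : D -> D -> D).
Proof.
split=> [x a u v | x a u v] /=.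
  by rewrite mulrDl scalerAl.
by rewrite mulrDr scalerAr.
Qed.

Definition alg_of : unital_alg D :=
  UnitalAlg falg_mul_bilinear (@mul1r D) (@mulr1 D).

End AlgOf.

Definition quaternion_algebra (F : fieldType) (D : falgType F) : Prop :=
  quaternion_subalgebra (alg_of D) {:D}.

Definition division_algebra (F : fieldType) (D : falgType F) : Prop :=
  forall x : D, x != 0 -> x \is a GRing.unit.

(* On a quaternion algebra exactly one map has these properties: if x is not
   in F, then x is a root of a unique monic quadratic polynomial X^2 - tX + n
   over F, and conj x = t - x. *)
Record canonical_involution (F : fieldType) (D : falgType F) :=
  CanonicalInvolution {
  conj :> {linear D -> D};
  conjK : involutive conj;
  conjM : forall x y, conj (x * y) = conj y * conj x;
  conj_trace : forall x, x + conj x \in 1%VS;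
  conj_norm : forall x, x * conj x \in 1%VS
}.

Section Cayley.
Variables (F : fieldType) (D : falgType F).
Variables (bar : canonical_involution D) (c : D).

Definition Cay_m_mul (x y : D * D) : D * D :=
  (x.1 * y.1 + bar y.2 * c * x.2, y.2 * x.1 + x.2 * bar y.1).

Definition Cay_r_mul (x y : D * D) : D * D :=
  (x.1 * y.1 + bar y.2 * x.2 * c, y.2 * x.1 + x.2 * bar y.1).

Fact conj1 : bar 1 = 1.
Proof. by have := conjM bar (bar 1) 1; rewrite mulr1 conjK mulr1. Qed.

Fact Cay_m_bilinear : bilinear_for *:%R *:%R Cay_m_mul.
Proof.
split=> -[x1 x2] a [u1 u2] [v1 v2] /=; rewrite /Cay_m_mul /=;
  congr (_, _) => /=;
  rewrite ?linearP ?(mulrDl, mulrDr) -?(scalerAl, scalerAr) scalerDr;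
  by rewrite addrACA.
Qed.

Fact Cay_r_bilinear : bilinear_for *:%R *:%R Cay_r_mul.
Proof.
split=> -[x1 x2] a [u1 u2] [v1 v2] /=; rewrite /Cay_r_mul /=;
  congr (_, _) => /=;
  rewrite ?linearP ?(mulrDl, mulrDr) -?(scalerAl, scalerAr) scalerDr;
  by rewrite addrACA.
Qed.

Fact Cay_m_mul1x : left_id (1, 0) Cay_m_mul.
Proof.
by case=> u v; rewrite /Cay_m_mul /= mul1r mulr0 mul0r mulr1 !addr0.
Qed.

Fact Cay_m_mulx1 : right_id (1, 0) Cay_m_mul.
Proof.
by case=> u v; rewrite /Cay_m_mul /= linear0 conj1 !mul0r !mulr1 addr0 add0r.
Qed.

Fact Cay_r_mul1x : left_id (1, 0) Cay_r_mul.
Proof.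
by case=> u v; rewrite /Cay_r_mul /= mul1r mulr0 !mul0r mulr1 !addr0.
Qed.

Fact Cay_r_mulx1 : right_id (1, 0) Cay_r_mul.
Proof.
by case=> u v; rewrite /Cay_r_mul /= linear0 conj1 !mul0r !mulr1 addr0 add0r.
Qed.

Definition Cay_m : unital_alg (D * D)%type :=
  UnitalAlg Cay_m_bilinear Cay_m_mul1x Cay_m_mulx1.

Definition Cay_r : unital_alg (D * D)%type :=
  UnitalAlg Cay_r_bilinear Cay_r_mul1x Cay_r_mulx1.

End Cayley.

Section Embedding.
Variables (F : fieldType) (D : falgType F).

Definition emb (u : D) : D * D := (u, 0).

Fact emb_linear : linear emb.
Proof. by move=> a u v; congr (_, _); rewrite /= scaler0 addr0. Qed.

HB.instance Definition _ :=
  GRing.isLinear.Build F D (D * D)%type *:%R emb emb_linear.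

(* D identified with the subspace D (+) 0 of D (+) D. *)
Definition D0 : {vspace (D * D)%type} := limg (linfun emb).

Fact mem_D0 (x : D * D) : (x \in D0) = (x.2 == 0).
Proof.
apply/memv_imgP/eqP => [[u _ ->]|]; first by rewrite lfunE.
by case: x => u v /= ->; exists u; rewrite ?memvf // lfunE.
Qed.

End Embedding.
Arguments D0 {F} D.

(* Main.v *)
Require Import Defs.
From mathcomp Require Import all_boot all_order all_algebra all_field.
Import GRing.Theory.
Local Open Scope ring_scope.

(* Both algebras have a product of the form
     (u, v)(u', v') = (u u' + g v' v, v' u + v (bar u'))
   with g v v outside F for v <> 0.  Let B be an associative subalgebra and
   x = (u, v) in B with v <> 0; put w = g v v.  Comparing components in
   x (x x) = (x x) x gives bar w = w and u w = w u.  As w is not in F, the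
   first identity forces characteristic 2, and u lies in the centraliser
   F + F w of w, so bar u = u and (w, 0) = x x - u (bar u) lies in B.
   If y = (u', v') is in B with v' <> 0, then u' commutes with w' = g v' v';
   applied to y + (w, 0), this shows that w commutes with w' too, hence with
   u', as the centraliser of w' is commutative.  So (w, 0) is central in B but
   not scalar: a quaternion subalgebra has no such x and is contained in D. *)

Lemma quaternion_center (F : fieldType) (D : falgType F) (z : D) :
  quaternion_algebra D -> (forall x, z * x = x * z) -> z \in 1%VS.
Proof.
case=> _ _ cenD _ _ zC.
by apply: cenD; rewrite ?memvf // => x _; apply: zC.
Qed.

(** The centraliser is a division subalgebra, so its dimension divides 4; it is not 4, since [z]
    would then be central and hence in F. *)
Lemma dim_centraliser1 (F : fieldType) (D : falgType F) (z : D) :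
    quaternion_algebra D -> division_algebra D -> z \notin 1%VS ->
  (\dim 'C[z] <= 2)%N.
Proof.
move=> quatD divD zF; case: (quatD) => _ _ _ _ dimD.
have CD : ('C[z]%AS <= {:D}%AS)%VS by apply: subvf.
have := skew_field_dimS divD CD; rewrite [\dim {:D}]dimD => dvd4.
have : \dim 'C[z] != 4.
  apply: contra zF => dimC; apply: quaternion_center => // x.
  have/eqP eqC : ('C[z] == {:D})%VS by rewrite eqEdim subvf (eqP dimC) dimD.
  by apply/esym/cent1vP; rewrite eqC memvf.
by move: dvd4 => /[dup] /dvdn_leq; case: (\dim _) => [|[|[|[|[|]]]]] // /(_ isT).
Qed.

(** [F + F z] is two-dimensional and lies in the centraliser, whose dimension is at most 2. *)
Lemma centraliser1_span (F : fieldType) (D : falgType F) (z x : D) :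
    quaternion_algebra D -> division_algebra D -> z \notin 1%VS ->
    z * x = x * z ->
  exists a b : F, x = a%:A + b *: z.
Proof.
move=> quatD divD zF zx.
have sub : (1 + <[z]> <= 'C[z])%VS.
  by rewrite subv_add -!memvE cent1v1 cent1v_id.
have z0 : z != 0 by apply: contraNneq zF => ->; rewrite mem0v.
have dim2 : \dim (1 + <[z]>)%VS = 2.
  rewrite dimv_disjoint_sum ?dimv1 ?dim_vline ?z0 //.
  apply/eqP; rewrite -subv0; apply/subvP => a.
  rewrite memv_cap memv0 => /andP[aF /vlineP[k def_a]]; apply: contraNT zF => a0.
  have k0 : k != 0 by apply: contraNneq a0 => k0; rewrite def_a k0 scale0r.
  by have := memvZ k^-1 aF; rewrite def_a scalerA mulVf // scale1r.
have/eqP eqC : (1 + <[z]> == 'C[z])%VS.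
  by rewrite eqEdim sub dim2 dim_centraliser1.
have : x \in 'C[z]%VS by apply/cent1vP.
rewrite -eqC => /memv_addP[_ /vlineP[a ->]] [_ /vlineP[b ->]] ->.
by exists a, b.
Qed.

Section Involution.
Context {F : fieldType} {D : falgType F} (bar : canonical_involution D).

Lemma bar_scalar (k : F) : bar k%:A = k%:A.
Proof. by rewrite linearZ /= conj1. Qed.

Lemma bar_normC (x : D) : x * bar x = bar x * x.
Proof.
have /vlineP[k xk] := conj_trace bar x.
have -> : bar x = k%:A - x by rewrite -xk addrC addKr.
by rewrite mulrBr mulrBl -scalerAl -scalerAr mul1r mulr1.
Qed.

(** The trace [w + bar w = 2 w] lies in F while [w] does not, which forces 2 = 0 in F. *)
Lemma bar_fixed_char2 (w x : D) : w \notin 1%VS -> bar w = w -> x + x = 0.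
Proof.
move=> wF bar_w; have := conj_trace bar w; rewrite bar_w -!mulr2n -!scaler_nat.
have [-> _ | two0 /(memvZ 2%:R^-1)] := eqVneq (2%:R : F) 0.
  by rewrite scale0r.
by rewrite scalerA mulVf // scale1r (negPf wF).
Qed.

Lemma bar_fixed_centralizer (w x : D) :
    quaternion_algebra D -> division_algebra D -> w \notin 1%VS ->
  bar w = w -> w * x = x * w -> bar x = x.
Proof.
move=> quatD divD wF bar_w /(centraliser1_span _ _ _ _ quatD divD wF)[a [b ->]].
by rewrite linearD bar_scalar linearZ /= bar_w.
Qed.

End Involution.

Section GeneralizedDoubling.
Context {F : fieldType} {D : falgType F} (bar : canonical_involution D).
(** Common form of both algebras: [g v' v] is [bar v' * c * v] for [Cay_m] and [bar v' * v * c] for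
    [Cay_r]. *)
Context (A : unital_alg (D * D)%type) (g : D -> D -> D).
Hypotheses
  (amulE : forall x y, amul A x y =
     (x.1 * y.1 + g y.2 x.2, y.2 * x.1 + x.2 * bar y.1))
  (aoneE : aone A = (1, 0))
  (g0l : forall v, g 0 v = 0) (g0r : forall v, g v 0 = 0)
  (gZ : forall (k : F) v, g (k *: v) v = g v (k *: v))
  (quatD : quaternion_algebra D).

Lemma amul_emb (u u' : D) : amul A (emb u) (emb u') = emb (u * u').
Proof. by rewrite amulE /= g0l addr0 !mul0r addr0. Qed.

Lemma dim_D0 : \dim (D0 D) = 4.
Proof.
case: quatD => _ _ _ _ <-; apply: limg_dim_eq; apply/eqP; rewrite -subv0.
apply/subvP => u; rewrite memv_cap memv_ker memv0 lfunE => /andP[_ /eqP].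
by case=> ->.
Qed.

Lemma D0_quaternion : quaternion_subalgebra A (D0 D).
Proof.
have memD x : x \in D0 D -> exists u, x = emb u.
  by case: x => u v; rewrite mem_D0 /= => /eqP ->; exists u.
have embD u : emb u \in D0 D by rewrite mem_D0.
case: (quatD) => _ _ _ [_ simpleD] dimD; split; last exact: dim_D0.
- split=> [|_ _ /memD[u ->] /memD[v ->]]; last by rewrite amul_emb.
  by rewrite aoneE embD.
- by move=> _ _ _ /memD[u ->] /memD[v ->] /memD[w ->]; rewrite !amul_emb mulrA.
- move=> _ /memD[z ->] zC.
  have /vlineP[k ->] : z \in 1%VS.
    apply: quaternion_center => // x; have := zC _ (embD x).
    by rewrite !amul_emb => -[].
  by apply/vlineP; exists k; rewrite linearZ aoneE.
split=> [|I [ID idI]]; first by rewrite -dimv_eq0 dim_D0.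
have memI u : (u \in linfun (@emb F D) @^-1: I)%VS = (emb u \in I).
  by rewrite -memv_preim lfunE.
(* An ideal of [D0 D] pulls back along [emb] to an ideal of [D], to which simplicity of [D]
   applies. *)
have idJ : ideal_of (alg_of D) {:D} (linfun (@emb F D) @^-1: I)%VS.
  split=> [|b x _]; first exact: subvf.
  rewrite memI => xI; have [bx xb] := idI _ _ (embD b) xI.
  by rewrite !memI -!amul_emb.
case: (simpleD _ idJ) => [J0 | JD]; [left | right]; apply/eqP.
  rewrite -subv0; apply/subvP => x xI; have [u def_x] := memD _ (subvP ID _ xI).
  have /eqP u0 : u == 0 by rewrite -memv0 -J0 memI -def_x.
  by rewrite def_x u0 linear0 mem0v.
rewrite eqEsubv ID; apply/subvP => _ /memD[u ->].
by rewrite -memI JD memvf.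
Qed.

Hypotheses (divD : division_algebra D)
  (gF : forall v, v != 0 -> g v v \notin 1%VS).

Lemma power_assoc_commutes (u v : D) :
    let x := (u, v) in
    amul A x (amul A x x) = amul A (amul A x x) x -> v != 0 ->
  bar (g v v) = g v v /\ u * g v v = g v v * u.
Proof.
move=> x; rewrite !amulE /= => -[E1 E2] v0; split.
  (* Put [w = g v v]. Once [v] is cancelled on the left, the second components differ only in
     [bar w] against [w], because [u] and [bar u] commute. *)
  apply: (mulrI (divD v v0)); move: E2; rewrite -mulrDr -!mulrA -!mulrDr.
  move/(mulrI (divD v v0)); rewrite !mulrDl linearD /= conjM bar_normC.
  rewrite -!addrA => /addrI; rewrite [g v v + _]addrCA => /addrI.
  by rewrite [g v v + _]addrC => /addrI ->.
(* The second component of [x x] is [t v] with [t] the trace of [u], so by [gZ] the [g] terms of the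
   first components cancel. *)
have /vlineP[t tr_u] := conj_trace bar u.
have vt : v * u + v * bar u = t *: v by rewrite -mulrDr tr_u -scalerAr mulr1.
move: E1; rewrite vt gZ => /addIr.
by rewrite mulrDr mulrDl mulrA => /addrI.
Qed.

Section Subalgebra.
Context (B : {vspace (D * D)%type}).
Hypotheses (algB : subalgebra A B) (assocB : associative_on A B).

Lemma subalgebra_commutes (u v : D) : (u, v) \in B -> v != 0 ->
  bar (g v v) = g v v /\ g v v * u = u * g v v.
Proof.
by move=> xB; case/(power_assoc_commutes _ _ (assocB _ _ _ xB xB xB)) => -> ->.
Qed.

Lemma emb_g_mem (u v : D) : (u, v) \in B -> v != 0 -> emb (g v v) \in B.
Proof.
move=> xB v0; have [bar_w wu] := subalgebra_commutes _ _ xB v0.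
have bar_u := bar_fixed_centralizer bar _ _ quatD divD (gF _ v0) bar_w wu.
have /vlineP[n uu] := conj_norm bar u; rewrite bar_u in uu.
have := algB.2 _ _ xB xB; rewrite amulE /= bar_u uu.
(* The second component of [x x] is [v * u + v * u], which vanishes as 2 = 0 in F. *)
rewrite (bar_fixed_char2 bar _ _ (gF _ v0) bar_w).
have -> : emb (g v v) = (n%:A + g v v, 0) - n *: aone A.
  by rewrite aoneE; congr (_, _); rewrite /= ?scaler0 ?subr0 // addrC addKr.
by move=> xxB; rewrite memvB // memvZ // algB.1.
Qed.

Lemma emb_g_central (u v : D) : (u, v) \in B -> v != 0 ->
  {in B, forall y, amul A (emb (g v v)) y = amul A y (emb (g v v))}.
Proof.
move=> xB v0 [u' v'] yB; have [bar_w wu] := subalgebra_commutes _ _ xB v0.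
rewrite !amulE /= bar_w g0l g0r !addr0 !mul0r addr0 add0r; congr (_, _).
have [v'0 | v'0] := eqVneq v' 0.
  (* Here [(u + u', v)] lies in [B], so [g v v] commutes with [u + u'] and with [u], hence with
     [u']. *)
  have := memvD xB yB; rewrite v'0 => xyB.
  have [|_] := subalgebra_commutes (u + u') v _ v0.
    by rewrite -[v]addr0.
  by rewrite mulrDl mulrDr wu => /addrI.
have [bar_w' w'u'] := subalgebra_commutes _ _ yB v'0.
have [|_] := subalgebra_commutes (u' + g v v) v' _ v'0.
  by rewrite -[v']addr0; apply: memvD yB (emb_g_mem _ _ xB v0).
rewrite mulrDl mulrDr w'u' => /addrI w'w.
have [a [b ->]] := centraliser1_span _ _ _ _ quatD divD (gF _ v'0) w'w.
by rewrite mulrDl mulrDr -!scalerAl -!scalerAr mul1r mulr1 w'u'.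
Qed.

End Subalgebra.

Lemma quaternion_subalgebra_eq_D0 (B : {vspace (D * D)%type}) :
  quaternion_subalgebra A B <-> B = D0 D.
Proof.
split=> [[algB assocB centB _ dimB] | ->]; last exact: D0_quaternion.
apply/eqP; rewrite eqEdim dim_D0 dimB leqnn andbT; apply/subvP => -[u v] xB.
rewrite mem_D0 /=; apply: contraT => v0.
have wB := emb_g_mem _ algB assocB _ _ xB v0.
have := centB _ wB (emb_g_central _ algB assocB _ _ xB v0).
rewrite aoneE => /vlineP[k [wk _]].
by case/negP: (gF _ v0); rewrite wk memvZ ?memv_line.
Qed.

End GeneralizedDoubling.

Theorem theorem9 (F : fieldType) (D : falgType F)
    (quatD : quaternion_algebra D) (divD : division_algebra D)
    (bar : canonical_involution D)
    (c : D) (c_unit : c \is a GRing.unit) (c_notin_F : c \notin 1%VS) :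
  (forall B : {vspace (D * D)%type},
     quaternion_subalgebra (Cay_m bar c) B <-> B = D0 D) /\
  (forall B : {vspace (D * D)%type},
     quaternion_subalgebra (Cay_r bar c) B <-> B = D0 D).
Proof.
have normE v : v != 0 ->
    exists2 n : F, n != 0 & v * bar v = n%:A /\ bar v * v = n%:A.
  move=> v0; have uv := divD v v0; have /vlineP[n vn] := conj_norm bar v.
  exists n; last by rewrite -bar_normC.
  (* If the norm were 0, cancelling [v] would give [bar v = 0], hence [v = 0]. *)
  apply: contraNneq v0 => n0; rewrite -(conjK bar v).
  have -> : bar v = 0 by apply: (mulrI uv); rewrite mulr0 vn n0 scale0r.
  by rewrite linear0.
have ncF (n : F) : n != 0 -> n *: c \notin 1%VS.
  move=> n0; apply: contra c_notin_F => /(memvZ n^-1).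
  by rewrite scalerA mulVf ?scale1r.
split=> B.
  apply: (quaternion_subalgebra_eq_D0 bar _ (fun v' v => bar v' * c * v)) => //.
  - by move=> v; rewrite linear0 !mul0r.
  - by move=> v; rewrite mulr0.
  - by move=> k v; rewrite linearZ /= -!scalerAl -scalerAr.
  move=> v v0; have [n n0 [vv' v'v]] := normE v v0.
  apply: contra (ncF _ (mulf_neq0 n0 n0)) => /vlineP[k def_k].
  (* Multiplying [bar v * c * v = k] by [v] on the left and by [bar v] on the right gives
     [n^2 c = k n]. *)
  apply/vlineP; exists (k * n).
  have : v * (bar v * c * v) * bar v = v * k%:A * bar v by rewrite def_k.
  rewrite !mulrA vv' -mulrA vv' -!scalerAr -!scalerAl !mulr1 mul1r vv'.
  by rewrite !scalerA.
apply: (quaternion_subalgebra_eq_D0 bar _ (fun v' v => bar v' * v * c)) => //.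
- by move=> v; rewrite linear0 !mul0r.
- by move=> v; rewrite mulr0 mul0r.
- by move=> k v; rewrite linearZ /= -!scalerAr -!scalerAl.
move=> v v0; have [n n0 [_ ->]] := normE v v0.
by rewrite -scalerAl mul1r ncF.
Qed.
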